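(* Let $r\ge 0$ be a real number, let $l=\{a_i\,;\,i=1,2,3,\ldots\}$ be a sequence of real numbers and let $m$ be a number such that $|a_i|<m$ for all $i=1,2,3,\ldots$. If a real number $a$ is an $r$-statistical limit of $l$, then $0$ is a $[p(2r+u)]^{1/2}$-limit of the sequence $\sigma(l)$ of partial standard deviations of $l$, where $p=\max\{m^2+|a|^2,\ m+|a|\}$ and $u=(m+|a|)r$.
   Context: $N=\{1,2,3,\ldots\}$. For a real number $r\ge 0$ and a sequence $(x_n)$ of real numbers, a real number $x$ is an $r$-limit of $(x_n)$, written $x=r\text{-}\lim_{n\to\infty}x_n$, if for every $\varepsilon>0$ one has $|x_n-x|<r+\varepsilon$ for all but finitely many $n$ (an $r$-limit need not be unique). For a real sequence $l=\{a_i\}$, a real number $a$ is an $r$-statistical limit of $l$, written $a=r\text{-}stat\text{-}\lim l$, if for every $\varepsilon>0$ the number $0$ is an $r$-limit of the sequence $\frac1n|\{i\in N: i\le n,\ |a_i-a|\ge\varepsilon\}|$, $n=1,2,3,\ldots$ (here $|B|$ is the cardinality of a finite set $B$). Put $\mu_n=\frac1n\sum_{i=1}^n a_i$. The sequence of partial standard deviations of $l$ is $\sigma(l)=\{\sigma_n\,;\,n=1,2,3,\ldots\}$ with $\sigma_n=\left(\frac1n\sum_{i=1}^n (a_i-\mu_n)^2\right)^{1/2}$. *)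

(* Defs.v *)
From mathcomp Require Import all_boot all_order all_algebra.
From mathcomp Require Import all_classical all_reals topology.

Set Implicit Arguments.
Unset Strict Implicit.
Unset Printing Implicit Defensive.

Import Order.TTheory GRing.Theory Num.Theory.

Local Open Scope ring_scope.

(** A sequence x_1, x_2, ... is a function [nat -> R] whose value at 0 is
    ignored. *)

Definition r_limit (R : realType) (r : R) (x : nat -> R) (y : R) : Prop :=
  forall e : R, 0 < e -> \forall n \near \oo%classic, `|x n - y| < r + e.

Definition deviation_set (R : realType) (l : nat -> R) (a e : R) (n : nat) :
    {set 'I_n.+1} :=
  [set i : 'I_n.+1 | (1 <= i)%N && (e <= `|l i - a|)]%SET.

Definition r_stat_limit (R : realType) (r : R) (l : nat -> R) (a : R) : Prop :=
  forall e : R, 0 < e ->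
    r_limit r (fun n => n%:R^-1 * #|deviation_set l a e n|%:R) 0.

Definition partial_mean (R : realType) (l : nat -> R) (n : nat) : R :=
  n%:R^-1 * \sum_(1 <= i < n.+1) l i.

Definition partial_sd (R : realType) (l : nat -> R) (n : nat) : R :=
  Num.sqrt (n%:R^-1 * \sum_(1 <= i < n.+1) (l i - partial_mean l n) ^+ 2).

(* Main.v *)
Require Import Defs.
From mathcomp Require Import all_boot all_order all_algebra.
From mathcomp Require Import all_classical all_reals topology.
From mathcomp Require Import lra.

Import Order.TTheory GRing.Theory Num.Theory.

Local Open Scope ring_scope.

(** The mean minimises the mean squared distance, so the variance [sigma_n ^ 2]
    is at most the mean of [(a_i - a) ^ 2] ([variance_le_mean_sqr_dist]).  Fix a
    threshold [eta] and put [M = m + |a|], which bounds every [|a_i - a|].  A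
    term at distance less than [eta] from [a] contributes at most [eta ^ 2] to
    that mean and any other term at most [M ^ 2]; if [d_n] is the proportion of
    the latter, then [sigma_n ^ 2 <= eta ^ 2 + M ^ 2 * d_n]
    ([mean_sqr_dist_le]).  By hypothesis [d_n < r + delta] eventually, whatever
    [delta > 0] is, so [sigma_n ^ 2] eventually stays below [M ^ 2 * r] plus an
    arbitrarily small amount.  Since [p >= M], also
    [M ^ 2 * r <= p * (M * r) <= p * (2 * r + u)]. *)

(** The cross term in the expansion of [(l i - a) ^ 2] around the mean sums
    to 0, which leaves the variance plus the square of the distance from [a] to
    the mean. *)
Lemma variance_le_mean_sqr_dist (R : realType) (l : nat -> R) (a : R) n :
  n%:R^-1 * \sum_(1 <= i < n.+1) (l i - partial_mean l n) ^+ 2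
  <= n%:R^-1 * \sum_(1 <= i < n.+1) (l i - a) ^+ 2.
Proof.
case: n => [|n]; first by rewrite !big_geq // mulr0.
rewrite ler_wpM2l ?invr_ge0 ?ler0n //.
set mu := partial_mean l n.+1.
have centered : \sum_(1 <= i < n.+2) (l i - mu) = 0.
  rewrite big_split /= sumr_const_nat subSS subn0 mulNrn -mulr_natl.
  by rewrite mulVKf ?subrr // pnatr_eq0.
have split_sqr i :
    (l i - a) ^+ 2
    = (l i - mu) ^+ 2 + 2 * (mu - a) * (l i - mu) + (mu - a) ^+ 2.
  by lra.
rewrite (eq_bigr _ (fun i _ => split_sqr i)) !big_split /= -mulr_sumr centered.
by rewrite mulr0 addr0 lerDl sumr_ge0 // => i _; exact: sqr_ge0.
Qed.

(** Counting as a sum of indicators lets the number of deviating terms be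
    compared with a sum of squares term by term. *)
Lemma card_deviation_set (R : realType) (l : nat -> R) (a e : R) n :
  #|deviation_set l a e n|%:R
  = \sum_(1 <= i < n.+1) (e <= `|l i - a|)%R%:R :> R.
Proof.
rewrite -sum1_card natr_sum big_mkcond big_ord_recl inE /= add0r.
rewrite big_add1 /= big_mkord.
by apply: eq_bigr => i _; rewrite inE /= /bump /= add1n; case: ifP.
Qed.

(** A term within [e] of [a] is charged [e ^ 2] and any other one [M ^ 2]. *)
Lemma mean_sqr_dist_le (R : realType) (l : nat -> R) (a M e : R) n :
  0 <= e -> (forall i, (1 <= i)%N -> `|l i - a| <= M) ->
  n%:R^-1 * \sum_(1 <= i < n.+1) (l i - a) ^+ 2
  <= e ^+ 2 + M ^+ 2 * (n%:R^-1 * #|deviation_set l a e n|%:R).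
Proof.
move=> e_ge0 l_near; case: n => [|n].
  by rewrite invr0 !mul0r mulr0 addr0 sqr_ge0.
have n_neq0 : n.+1%:R != 0 :> R by rewrite pnatr_eq0.
rewrite -[e ^+ 2](mulKf n_neq0) [M ^+ 2 * _]mulrCA -mulrDr.
rewrite ler_wpM2l ?invr_ge0 ?ler0n // card_deviation_set.
have -> : n.+1%:R * e ^+ 2 = \sum_(1 <= i < n.+2) e ^+ 2.
  by rewrite sumr_const_nat subSS subn0 mulr_natl.
rewrite mulr_sumr -big_split /=.
apply: ler_sum_nat => i /andP[i_ge1 _]; rewrite -(real_normK (num_real (l i - a))).
have dist_leM := l_near i i_ge1.
case: (lerP e) => dist_e /=.
  rewrite mulr1 ler_wpDl ?sqr_ge0 //.
  by rewrite lerXn2r ?nnegrE // (le_trans _ dist_leM).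
by rewrite mulr0 addr0 lerXn2r ?nnegrE // ltW.
Qed.

Theorem theorem3p2 (R : realType) (r : R) (l : nat -> R) (m a : R)
    (r_ge0 : 0 <= r)
    (l_bounded : forall i : nat, (1 <= i)%N -> `|l i| < m)
    (a_stat_limit : r_stat_limit r l a) :
  let p := Num.max (m ^+ 2 + `|a| ^+ 2) (m + `|a|) in
  let u := (m + `|a|) * r in
  r_limit (Num.sqrt (p * (2 * r + u))) (partial_sd l) 0.
Proof.
move=> p u e e_gt0; set M := m + `|a| in p u *.
have m_gt0 : 0 < m := le_lt_trans (normr_ge0 _) (l_bounded 1%N isT).
have M_ge0 : 0 <= M by rewrite addr_ge0 // ltW.
have dist_leM i : (1 <= i)%N -> `|l i - a| <= M.
  by move=> i_ge1; rewrite (le_trans (ler_normB _ _)) // lerD2r ltW ?l_bounded.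
have p_geM : M <= p by rewrite le_max lexx orbT.
have p_ge0 : 0 <= p := le_trans M_ge0 p_geM.
have u_ge0 : 0 <= u by rewrite mulr_ge0.
have P_ge : M ^+ 2 * r <= p * (2 * r + u).
  by rewrite expr2 -mulrA -/u ler_pM // lerDr mulr_ge0.
have P_ge0 : 0 <= p * (2 * r + u) by rewrite mulr_ge0 ?addr_ge0 ?mulr_ge0.
have M2_gt0 : 0 < M ^+ 2 + 1 by rewrite ltr_wpDl ?sqr_ge0.
(* The threshold [e / 2] costs [e ^ 2 / 4] in the variance bound, and [delta]
   is such that [M ^ 2 * delta <= e ^ 2 / 4]; together they stay below
   [e ^ 2]. *)
pose delta := e ^+ 2 / 4 / (M ^+ 2 + 1).
have e2_gt0 : 0 < e ^+ 2 by rewrite exprn_gt0.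
have delta_gt0 : 0 < delta by rewrite !divr_gt0.
have delta_le : M ^+ 2 * delta <= e ^+ 2 / 4.
  rewrite -[leRHS](divfK (lt0r_neq0 M2_gt0)) -/delta mulrC.
  by rewrite ler_wpM2l ?ltW // ltrDl.
have half_gt0 : 0 < e / 2 by rewrite divr_gt0.
apply: filterS (a_stat_limit _ half_gt0 _ delta_gt0) => n.
rewrite !subr0 => /(le_lt_trans (ler_norm _))/ltW few_dev.
rewrite ger0_norm ?sqrtr_ge0 //.
set P := p * _ in P_ge P_ge0 *.
have bound_gt0 : 0 < Num.sqrt P + e by rewrite ltr_wpDl ?sqrtr_ge0.
rewrite -[ltRHS](ger0_norm (ltW bound_gt0)) -sqrtr_sqr ltr_sqrt ?exprn_gt0 //.
apply: le_lt_trans (variance_le_mean_sqr_dist _ l a n) _.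
apply: le_lt_trans (mean_sqr_dist_le _ _ _ _ _ n (ltW half_gt0) dist_leM) _.
have := ler_wpM2l (sqr_ge0 M) few_dev; rewrite mulrDr => dev_le.
have cross_ge0 : 0 <= Num.sqrt P * e by rewrite mulr_ge0 ?sqrtr_ge0 ?ltW.
rewrite [ltRHS]sqrrD sqr_sqrtr // exprMn exprVn.
by lra.
Qed.
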